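(* Let $G$ be a finite group. The graph $\Gamma^*(G)$ is the line graph of some graph if and only if one of the following conditions holds: (1) $G$ is abelian. (2) $G$ is a non-abelian group with trivial center, and the centralizer $C_G(x)$ of every non-central element $x$ of $G$ is abelian.
   Context: All graphs are simple (no loops or multiple edges) and undirected; a graph with no vertices is allowed. The commuting graph $\Gamma(G)$ of a group $G$ is the simple undirected graph whose vertex set is the set of all elements of $G$, in which two distinct elements $x$ and $y$ are adjacent if and only if $xy=yx$. The graph $\Gamma^*(G)$ is the induced subgraph of $\Gamma(G)$ obtained by deleting the identity element of $G$. The line graph $L(\Gamma)$ of a graph $\Gamma$ is the graph whose vertices are the edges of $\Gamma$, two distinct vertices of $L(\Gamma)$ being adjacent if and only if the corresponding edges of $\Gamma$ share an endpoint. A graph is ''the line graph of some graph'' if it is isomorphic to $L(\Gamma)$ for some simple graph $\Gamma$. $C_G(x)$ denotes the centralizer of $x$ in $G$, and an element is non-central if it does not lie in the center $Z(G)$. *)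

(* Defs.v *)
From mathcomp Require Import all_boot all_fingroup all_solvable.
From mathcomp Require Import boolp classical_sets.

Set Implicit Arguments.
Unset Strict Implicit.
Unset Printing Implicit Defensive.

(* Vertex types are arbitrary: they may be infinite, or empty. *)
Record graph := Graph {
  vertex :> Type;
  adj : vertex -> vertex -> Prop;
  adj_sym : forall x y, adj x y -> adj y x;
  adj_irr : forall x, ~ adj x x
}.

Definition isomorphic (A B : graph) : Prop :=
  exists2 f : A -> B, bijective f & forall x y, adj x y <-> adj (f x) (f y).

Section Induced.
Variables (A : graph) (S : set A).

Definition induced_adj (x y : set_type S) : Prop := adj (val x) (val y).

Lemma induced_adj_sym x y : induced_adj x y -> induced_adj y x.
Proof. exact: adj_sym. Qed.

Lemma induced_adj_irr x : ~ induced_adj x x.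
Proof. exact: adj_irr. Qed.

Definition induced_subgraph : graph := Graph induced_adj_sym induced_adj_irr.

End Induced.

Section LineGraph.
Variable A : graph.

Definition edges : set (set A) :=
  [set E | exists x y : A, adj x y /\ E = [set x; y]%classic]%classic.

Definition line_adj (E F : set_type edges) : Prop :=
  E <> F /\ exists v : A, val E v /\ val F v.

Lemma line_adj_sym E F : line_adj E F -> line_adj F E.
Proof. by case=> neq [v [Ev Fv]]; split; [exact/nesym | exists v]. Qed.

Lemma line_adj_irr E : ~ line_adj E E.
Proof. by case. Qed.

Definition line_graph : graph := Graph line_adj_sym line_adj_irr.

End LineGraph.

Definition is_line_graph (A : graph) : Prop :=
  exists B : graph, isomorphic A (line_graph B).

Section CommutingGraph.
Variables (gT : finGroupType) (G : {group gT}).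

Definition commuting_adj (x y : [subg G]) : Prop := x <> y /\ commute x y.

Lemma commuting_adj_sym x y : commuting_adj x y -> commuting_adj y x.
Proof. by case=> neq cxy; split; [exact/nesym | exact/commute_sym]. Qed.

Lemma commuting_adj_irr x : ~ commuting_adj x x.
Proof. by case. Qed.

Definition commuting_graph : graph :=
  Graph commuting_adj_sym commuting_adj_irr.

Definition commuting_graph_star : graph :=
  @induced_subgraph commuting_graph [set x : [subg G] | x <> 1%g]%classic.

End CommutingGraph.

(* Main.v *)
Require Import Defs.
From mathcomp Require Import all_boot all_fingroup all_solvable.
From mathcomp Require Import boolp classical_sets.

(** The disjunction of the two conditions says that the centralizer of every
    non-identity element of G is abelian ([centralizers_abelianP]): a
    non-trivial central element has centralizer G.

    If some non-identity x has a non-abelian centralizer, pick a, b in it that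
    do not commute.  Then a, b and a * b pairwise do not commute while x
    commutes with all three (and so is none of them): x, a, b, a * b induce a
    claw ([nonabelian_centralizer_claw]).  A line graph has no induced claw,
    since among three edges meeting a given edge two must meet it at the same
    endpoint ([line_graph_claw_free]).

    If conversely all these centralizers are abelian, then commuting is a
    transitive relation on non-identity elements, the graph is a disjoint union
    of cliques, and it is the line graph of a disjoint union of stars
    ([cluster_is_line_graph]). *)

Definition has_claw (A : graph) : Prop :=
  exists x a b c : A, [/\ adj x a, adj x b & adj x c] /\
    [/\ a <> b, a <> c & b <> c] /\ [/\ ~ adj a b, ~ adj a c & ~ adj b c].

(** Pigeonhole: three edges meet the centre {u, v} of a claw in u or v, so two
    of them share an endpoint. *)
Lemma line_graph_claw_free (A : graph) : is_line_graph A -> ~ has_claw A.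
Proof.
case=> B [f fbij fadj] [x [a [b [c [[xa xb xc] [[ab ac bc] [nab nac nbc]]]]]]].
have finj := bij_inj fbij.
have disj (p q : A) w : p <> q -> ~ adj p q ->
    val (f p) w -> val (f q) w -> False.
  move=> npq nadj pw qw; apply/nadj/fadj; split; last by exists w.
  by move/finj.
have [u [v [_ fxE]]] : edges (val (f x)) := set_mem (valP (f x)).
have meet y : adj x y -> val (f y) u \/ val (f y) v.
  by case/fadj=> _ [w []]; rewrite fxE => -[->|->]; [left | right].
case: (meet a xa) => wa; case: (meet b xb) => wb; case: (meet c xc) => wc;
  solve [exact: disj ab nab wa wb | exact: disj ac nac wa wc
        | exact: disj bc nbc wb wc].
Qed.

Section StarForest.
Variable A : graph.

Definition closed_nbhd (x : A) : set A := [set y | y = x \/ adj x y]%classic.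

Definition star_adj (p q : A + set A) : Prop :=
  match p, q with
  | inl x, inr N | inr N, inl x => N = closed_nbhd x
  | _, _ => False
  end.

Lemma star_adj_sym p q : star_adj p q -> star_adj q p.
Proof. by move: p q => [x|M] [y|N]. Qed.

Lemma star_adj_irr p : ~ star_adj p p.
Proof. by move: p => [x|N]. Qed.

(** When [A] is a disjoint union of cliques, its cliques are the closed
    neighbourhoods; each is the hub of a star whose leaves are its members.
    Sets that are not closed neighbourhoods are isolated vertices, which
    contribute nothing to the line graph. *)
Definition star_forest : graph := Graph star_adj_sym star_adj_irr.

Definition spoke_set (x : A) : set star_forest :=
  [set (inl x : star_forest); (inr (closed_nbhd x) : star_forest)]%classic.

Lemma spoke_set_edge x : spoke_set x \in @edges star_forest.
Proof. by apply: mem_set; exists (inl x), (inr (closed_nbhd x)). Qed.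

Definition spoke (x : A) : line_graph star_forest :=
  exist _ (spoke_set x) (spoke_set_edge x).

Lemma spoke_inj : injective spoke.
Proof.
move=> x y /(congr1 val) /= exy.
have : spoke_set y (inl x) by rewrite -exy; left.
by case=> // -[].
Qed.

Lemma spoke_surj (E : line_graph star_forest) : exists x, spoke x = E.
Proof.
have [[x|M] [[y|N] [//= pq defE]]] := set_mem (valP E);
  [exists x | exists y]; apply: val_inj; rewrite /= defE pq //.
by rewrite /spoke_set setUC.
Qed.

Lemma spoke_bij : bijective spoke.
Proof.
have [g gK] := choice spoke_surj.
by exists g => // x; apply: spoke_inj.
Qed.

(** Leaves give [spoke] its injectivity, and it is onto because a leaf has only
    one neighbour; so the edges of the star forest always biject with the
    vertices of [A].  Transitivity enters only to match the adjacencies: distinct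
    spokes meet exactly when they share a hub, and it makes adjacent vertices
    have the same closed neighbourhood. *)
Lemma cluster_is_line_graph :
    (forall x y z : A, adj x y -> adj y z -> x <> z -> adj x z) ->
  is_line_graph A.
Proof.
move=> trA; exists star_forest; exists spoke; first exact: spoke_bij.
have sub x y : adj x y -> (closed_nbhd y `<=` closed_nbhd x)%classic.
  move=> xy z [->|yz]; first by right.
  by have [->|nzx] := pselect (z = x); [left | right; apply: trA xy yz _ => /esym].
move=> x y; split=> [xy | [nxy [v [/= xv yv]]]].
  split=> [/spoke_inj exy | ]; first by rewrite exy in xy; exact: adj_irr xy.
  exists (inr (closed_nbhd x)); split; right => //=; congr inr.
  by apply/seteqP; split; apply: sub => //; apply: adj_sym.
case: xv yv => -> [] // => [[exy]|[eN]]; first by case: nxy; rewrite exy.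
have : closed_nbhd x y by rewrite eN; left.
by case=> // eyx; case: nxy; rewrite eyx.
Qed.

End StarForest.

Section CommutingGraphs.
Variables (gT : finGroupType) (G : {group gT}).
Local Open Scope group_scope.

Definition abelian_centralizers : Prop :=
  forall x : gT, x \in G -> x != 1 -> abelian 'C_G[x].

Lemma centralizers_abelianP :
  abelian_centralizers <->
  (abelian G \/
   (~~ abelian G /\ 'Z(G) = 1 /\
    (forall x : gT, x \in G -> x \notin 'Z(G) -> abelian 'C_G[x]))).
Proof.
split=> [abC | [abG x _ _ | [_ [Z1 abC]] x Gx ntx]]; last 2 first.
- exact: abelianS (subsetIl _ _) abG.
- by apply: abC; rewrite // Z1 inE.
have [abG | nabG] := boolP (abelian G); [by left | right; split=> //].
split=> [|x Gx]; last first.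
  by move=> nZx; apply: abC => //; apply: contraNneq nZx => ->; apply: group1.
apply/trivgP/fintype.subsetP=> z /centerP[Gz cz]; rewrite inE.
apply: contraNT nabG => ntz; apply: abelianS (abC z Gz ntz).
by apply/fintype.subsetP=> y Gy; rewrite inE Gy; apply/cent1P/commute_sym/cz.
Qed.

Let star_vertex := vertex (commuting_graph_star G).

Definition elt (v : star_vertex) : gT := sgval (val v).

Lemma elt_inj : injective elt.
Proof. by move=> u v /val_inj/val_inj. Qed.

Lemma eltP (v : star_vertex) : elt v \in G /\ elt v != 1.
Proof.
split; first exact: subgP.
by apply/eqP => v1; apply: (set_mem (valP v)); apply: val_inj.
Qed.

Lemma elt_surj x : x \in G -> x != 1 -> exists v, elt v = x.
Proof.
move=> Gx /eqP ntx.
have mx : subg G x \in [set x : [subg G] | x <> 1]%classic.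
  by apply: mem_set => /(congr1 val) /=; rewrite subgK.
by exists (exist _ (subg G x) mx); rewrite /elt /= subgK.
Qed.

Lemma commute_subg (u v : [subg G]) :
  commute u v <-> commute (sgval u) (sgval v).
Proof. by split=> [/(congr1 val) | c] //; apply: val_inj. Qed.

Lemma adj_eltP (u v : star_vertex) :
  adj u v <-> elt u <> elt v /\ commute (elt u) (elt v).
Proof.
split=> -[neq /commute_subg c]; split=> //.
- by move/val_inj.
- by move=> euv; apply: neq; rewrite /elt euv.
Qed.

Lemma abelian_centralizers_line_graph :
  abelian_centralizers -> is_line_graph (commuting_graph_star G).
Proof.
move=> abC; apply: cluster_is_line_graph => x y z.
move=> /adj_eltP[_ cxy] /adj_eltP[_ cyz] nxz.
apply/adj_eltP; split; first by move/elt_inj.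
have [Gy nty] := eltP y.
have /centsP cC := abC _ Gy nty.
by apply: cC; rewrite inE (proj1 (eltP _)); apply/cent1P.
Qed.

Lemma noncommuting_vertices (u v : star_vertex) :
  ~ commute (elt u) (elt v) -> u <> v /\ ~ adj u v.
Proof. by move=> nuv; split=> [uv | /adj_eltP[_ //]]; apply: nuv; rewrite uv. Qed.

(** The leaves are a, b and a * b, where a and b do not commute: cancelling a
    on the left, or b on the right, shows that a * b commutes with neither. *)
Lemma nonabelian_centralizer_claw (x : gT) :
  x \in G -> x != 1 -> ~~ abelian 'C_G[x] -> has_claw (commuting_graph_star G).
Proof.
move=> Gx ntx /fintype.subsetPn[a Ca nCa].
have [b Cb nab] : exists2 b, b \in 'C_G[x] & ~ commute a b.
  apply: contrapT => noB; case/negP: nCa; apply/centP => b Cb.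
  by apply: contrapT => nab; apply: noB; exists b.
have naab : ~ commute a (a * b).
  by rewrite /commute -mulgA => /mulgI.
have nbab : ~ commute b (a * b).
  by rewrite /commute mulgA => /mulIg /esym.
have [vx vxE] := elt_surj x Gx ntx.
have leaf y w : y \in 'C_G[x] -> w \in 'C_G[x] -> ~ commute y w ->
    exists2 v, elt v = y & adj vx v.
  move=> /setIP[Gy /cent1P/commute_sym cxy] /setIP[_ /cent1P/commute_sym cxw] nyw.
  have [|v vE] := elt_surj y Gy.
    by apply: contra_notN nyw => /eqP ->; apply/commute_sym/commute1.
  exists v => //; apply/adj_eltP; rewrite vxE vE.
  by split=> // xy; apply: nyw; rewrite -xy.
have [va aE xa] := leaf a b Ca Cb nab.
have [vb bE xb] := leaf b a Cb Ca (fun ba => nab (commute_sym ba)).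
have [vc cE xc] := leaf (a * b) a (groupM Ca Cb) Ca (fun c => naab (commute_sym c)).
rewrite -cE -aE in naab; rewrite -cE -bE in nbab; rewrite -aE -bE in nab.
have [ab nadj_ab] := noncommuting_vertices va vb nab.
have [ac nadj_ac] := noncommuting_vertices va vc naab.
have [bc nadj_bc] := noncommuting_vertices vb vc nbab.
by exists vx, va, vb, vc.
Qed.

End CommutingGraphs.

Theorem theorem3p2 (gT : finGroupType) (G : {group gT}) :
  is_line_graph (commuting_graph_star G) <->
  (abelian G \/
   (~~ abelian G /\ ('Z(G) = 1)%g /\
    (forall x : gT, x \in G -> x \notin ('Z(G))%g -> abelian ('C_G[x])%g))).
Proof.
apply: iff_trans (centralizers_abelianP gT G).
split=> [lineG x Gx ntx | ]; last exact: abelian_centralizers_line_graph.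
apply: contrapT => /negP nabC; apply: (line_graph_claw_free _ lineG).
exact: nonabelian_centralizer_claw Gx ntx nabC.
Qed.
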